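(* The relation $\le_a$ is transitive: for all closed session types $T,V,S$, if $T\le_a V$ and $V\le_a S$ then $T\le_a S$.
   Context: Session types: $T,S ::= \&_{i\in I}?l_i(S_i).T_i \mid \bigoplus_{i\in I}!l_i\langle S_i\rangle.T_i \mid \mathbf t \mid \mu\mathbf t.T \mid \mathsf{end}$, with pairwise distinct labels in each branching/selection, closed exchanged types $S_i$ and contractive recursion; types are equi-recursive (identified when they have the same regular tree, so $\mu\mathbf t.T=T\{\mu\mathbf t.T/\mathbf t\}$). Asynchronous contexts: $\mathcal A ::= [\,]^n \mid \&_{i\in I}?l_i(S_i).\mathcal A_i$, with holes indexed by distinct indices; $\mathcal A[T_n]^{n\in N}$ denotes the context whose holes are indexed by $N$ with each hole $[\,]^n$ filled by $T_n$. Write $\&\in\mathcal A$ if $\mathcal A$ is not a single hole. The predicate $\&\in T$ (every continuation path of $T$ contains a branching) is defined inductively on possibly open types: $\&\in\&_{i\in I}?l_i(S_i).T_i$; $\&\in\bigoplus_{i\in I}!l_i\langle S_i\rangle.T_i$ if $\&\in T_i$ for all $i\in I$; $\&\in\mu\mathbf t.T$ if $\&\in T$. Asynchronous subtyping $\le_a$ is the largest (coinductively defined) relation on closed types such that $T\le_a S$ implies one of: $T=S=\mathsf{end}$; $T=\&_{i\in I\cup J}?l_i(S_i).T_i$, $S=\&_{i\in I}?l_i(S'_i).T'_i$ with $S_i\le_a S'_i$ and $T_i\le_a T'_i$ for all $i\in I$; $T=\bigoplus_{i\in I}!l_i\langle S_i\rangle.T_i$, $S=\bigoplus_{i\in I\cup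 J}!l_i\langle S'_i\rangle.T'_i$ with $S'_i\le_a S_i$ and $T_i\le_a T'_i$ for all $i\in I$; or $T=\bigoplus_{i\in I}!l_i\langle S_i\rangle.T_i$ and $S=\mathcal A[\bigoplus_{i\in I\cup J_n}!l_i\langle S^n_i\rangle.T^n_i]^{n\in N}$ for some asynchronous context $\mathcal A$ with $\&\in\mathcal A$, such that for all $i\in I$ and $n\in N$: $S^n_i\le_a S_i$, $T_i\le_a\mathcal A[T^n_i]^{n\in N}$, and $\&\in T_i$. *)

(* Defs.v *)
From Stdlib Require Import List PeanoNat.
Import ListNotations.

Set Implicit Arguments.

(** Session types over a set [L] of labels.  Recursion variables are natural
    numbers used as names.  An entry [(l, S, T)] of a branching (selection) is
    the summand [?l(S).T] (resp. [!l<S>.T]). *)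
Inductive ty (L : Type) : Type :=
| Bra (bs : list (L * ty L * ty L))
| Sel (bs : list (L * ty L * ty L))
| Var (t : nat)
| Mu (t : nat) (T : ty L)
| End.

Arguments Var {L} t.
Arguments End {L}.

Definition labels (L X Y : Type) (bs : list (L * X * Y)) : list L :=
  map (fun b => fst (fst b)) bs.

(** [guarded t T]: [T] is not of the form [mu t1. ... mu tn. t] with [t] free. *)
Fixpoint guarded (L : Type) (t : nat) (T : ty L) : Prop :=
  match T with
  | Var u => u <> t
  | Mu u T => u = t \/ guarded t T
  | _ => True
  end.

(** [wf ts T]: labels are pairwise distinct in each branching and selection,
    exchanged types are closed, recursion is contractive, and the free
    variables of [T] are among [ts]. *)
Inductive wf (L : Type) : list nat -> ty L -> Prop :=
| wf_Bra ts bs :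
    NoDup (labels bs) ->
    (forall l S T, In (l, S, T) bs -> wf [] S) ->
    (forall l S T, In (l, S, T) bs -> wf ts T) ->
    wf ts (Bra bs)
| wf_Sel ts bs :
    NoDup (labels bs) ->
    (forall l S T, In (l, S, T) bs -> wf [] S) ->
    (forall l S T, In (l, S, T) bs -> wf ts T) ->
    wf ts (Sel bs)
| wf_Var ts t : In t ts -> wf ts (Var t)
| wf_Mu ts t T : guarded t T -> wf (t :: ts) T -> wf ts (Mu t T)
| wf_End ts : wf ts End.

Definition closed_type (L : Type) (T : ty L) : Prop := wf [] T.

(** [T{U/t}] for a closed [U], so that no capture can occur.  Exchanged types
    are closed and hence left unchanged. *)
Fixpoint subst (L : Type) (t : nat) (U : ty L) (T : ty L) : ty L :=
  match T with
  | Bra bs => Bra (map (fun '(l, S0, T') => (l, S0, subst t U T')) bs)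
  | Sel bs => Sel (map (fun '(l, S0, T') => (l, S0, subst t U T')) bs)
  | Var u => if Nat.eqb u t then U else Var u
  | Mu u T' => if Nat.eqb u t then Mu u T' else Mu u (subst t U T')
  | End => End
  end.

(** [unfolds T U]: [U] is obtained from [T] by unfolding the recursions at its
    head until a branching, a selection or [End] appears. *)
Inductive unfolds (L : Type) : ty L -> ty L -> Prop :=
| unfolds_Bra bs : unfolds (Bra bs) (Bra bs)
| unfolds_Sel bs : unfolds (Sel bs) (Sel bs)
| unfolds_End : unfolds End End
| unfolds_Mu t T U : unfolds (subst t (Mu t T) T) U -> unfolds (Mu t T) U.

(** Branchings and selections are indexed families, so the order of the
    summands is irrelevant. *)
Definition same_summands (L : Type) (R : ty L -> ty L -> Prop)
    (bs cs : list (L * ty L * ty L)) : Prop :=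
  (forall l S T, In (l, S, T) bs ->
     exists S' T', In (l, S', T') cs /\ R S S' /\ R T T') /\
  (forall l S' T', In (l, S', T') cs ->
     exists S T, In (l, S, T) bs /\ R S S' /\ R T T').

Inductive tree_step (L : Type) (R : ty L -> ty L -> Prop) :
    ty L -> ty L -> Prop :=
| tree_End T U : unfolds T End -> unfolds U End -> tree_step R T U
| tree_Bra T U bs cs :
    unfolds T (Bra bs) -> unfolds U (Bra cs) -> same_summands R bs cs ->
    tree_step R T U
| tree_Sel T U bs cs :
    unfolds T (Sel bs) -> unfolds U (Sel cs) -> same_summands R bs cs ->
    tree_step R T U.

(** Equality of the regular trees of [T] and [U], as the largest bisimulation. *)
Definition same_tree (L : Type) (T U : ty L) : Prop :=
  exists R : ty L -> ty L -> Prop,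
    (forall T' U', R T' U' -> tree_step R T' U') /\ R T U.

(** Equality of equi-recursive closed types. *)
Definition ty_eq (L : Type) (T U : ty L) : Prop :=
  closed_type T /\ closed_type U /\ same_tree T U.

(** Asynchronous contexts; [Hole n] is the hole with index [n]. *)
Inductive actx (L : Type) : Type :=
| Hole (n : nat)
| CBra (bs : list (L * ty L * actx L)).

Arguments Hole {L} n.

(** The index set [N] of the holes of a context. *)
Fixpoint holes (L : Type) (A : actx L) : list nat :=
  match A with
  | Hole n => [n]
  | CBra bs => flat_map (fun '(_, _, A') => holes A') bs
  end.

(** [A[F n]^{n in N}]; only the values of [F] on [holes A] matter. *)
Fixpoint fill (L : Type) (A : actx L) (F : nat -> ty L) : ty L :=
  match A with
  | Hole n => F n
  | CBra bs => Bra (map (fun '(l, S0, A') => (l, S0, fill A' F)) bs)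
  end.

(** [& \in A] *)
Definition ctx_has_bra (L : Type) (A : actx L) : Prop :=
  forall n, A <> Hole n.

(** [& \in T] *)
Inductive has_bra (L : Type) : ty L -> Prop :=
| has_bra_Bra bs : has_bra (Bra bs)
| has_bra_Sel bs :
    (forall l S T, In (l, S, T) bs -> has_bra T) -> has_bra (Sel bs)
| has_bra_Mu t T : has_bra T -> has_bra (Mu t T).

(** In [async_selA], [cs n] lists the summands (indexed by [I] and [J_n]) of
    the selection in hole [n], and for the summand [i] of [T] the functions
    [Sn] and [Tn] give the families [S^n_i] and [T^n_i]. *)
Inductive async_step (L : Type) (R : ty L -> ty L -> Prop) :
    ty L -> ty L -> Prop :=
| async_end T S :
    ty_eq T End -> ty_eq S End -> async_step R T S
| async_bra T S bs cs :
    ty_eq T (Bra bs) -> ty_eq S (Bra cs) ->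
    (forall l Si' Ti', In (l, Si', Ti') cs ->
       exists Si Ti, In (l, Si, Ti) bs /\ R Si Si' /\ R Ti Ti') ->
    async_step R T S
| async_sel T S bs cs :
    ty_eq T (Sel bs) -> ty_eq S (Sel cs) ->
    (forall l Si Ti, In (l, Si, Ti) bs ->
       exists Si' Ti', In (l, Si', Ti') cs /\ R Si' Si /\ R Ti Ti') ->
    async_step R T S
| async_selA T S bs (A : actx L) (cs : nat -> list (L * ty L * ty L)) :
    ctx_has_bra A -> NoDup (holes A) ->
    ty_eq T (Sel bs) -> ty_eq S (fill A (fun n => Sel (cs n))) ->
    (forall l Si Ti, In (l, Si, Ti) bs ->
       exists Sn Tn : nat -> ty L,
         (forall n, In n (holes A) ->
            In (l, Sn n, Tn n) (cs n) /\ R (Sn n) Si) /\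
         R Ti (fill A Tn) /\ has_bra Ti) ->
    async_step R T S.

(** Asynchronous subtyping: the largest relation contained in its
    [async_step]. *)
Definition async_sub (L : Type) (T S : ty L) : Prop :=
  exists R : ty L -> ty L -> Prop,
    (forall T' S', R T' S' -> async_step R T' S') /\ R T S.

(* Main.v *)
(** The relational square of subtyping is closed under the rules that define
    subtyping.  The only case that is not immediate is [T <= V] by anticipating
    an output of [V = A[V_n]^{n in N}] past the context [A].  Then [V <= S] also
    yields [S = A'[S_m]^{m in M}], where each output common to all [V_n] can be
    chosen in all [S_m], leaving types which are again related; this is shown by
    induction on [A].  When [A] is a branching so is [A'], and when [A] is a hole
    the claim is a rule of subtyping.  The condition [& in T_i] is inherited
    downwards: if [T <= V] and [& in V] then [& in T]. *)

From Stdlib Require Import List PeanoNat Lia Classical.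
Require Import Defs.
Import ListNotations.

Set Implicit Arguments.

(** * Tree equality of equi-recursive types *)

Section Trees.
Variable L : Type.
Implicit Types T U V S : ty L.

Lemma unfolds_det T U V : unfolds T U -> unfolds T V -> U = V.
Proof.
  intros H; revert V; induction H; intros V HV; inversion HV; subst; auto.
Qed.

Lemma same_summands_mono (R R' : ty L -> ty L -> Prop) bs cs :
  (forall T U, R T U -> R' T U) ->
  same_summands R bs cs -> same_summands R' bs cs.
Proof.
  intros HR [H1 H2]; split.
  - intros l S T Hin; destruct (H1 _ _ _ Hin) as (S' & T' & ? & ? & ?); exists S', T'; auto.
  - intros l S T Hin; destruct (H2 _ _ _ Hin) as (S' & T' & ? & ? & ?); exists S', T'; auto.
Qed.

Lemma tree_step_mono (R R' : ty L -> ty L -> Prop) T U :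
  (forall T U, R T U -> R' T U) -> tree_step R T U -> tree_step R' T U.
Proof.
  intros HR H; destruct H.
  - apply tree_End; auto.
  - eapply tree_Bra; eauto using same_summands_mono.
  - eapply tree_Sel; eauto using same_summands_mono.
Qed.

Lemma same_tree_unfold T U : same_tree T U -> tree_step (@same_tree L) T U.
Proof.
  intros (R & HR & H). apply tree_step_mono with (R := R); [|auto].
  intros T' U' H'; exists R; auto.
Qed.

(** By monotonicity, one step over the largest bisimulation is again a bisimulation, hence contained
    in it. *)
Lemma same_tree_fold T U : tree_step (@same_tree L) T U -> same_tree T U.
Proof.
  intros H. exists (tree_step (@same_tree L)). split; [|exact H].
  intros T' U' H'. apply tree_step_mono with (R := @same_tree L); [|exact H'].
  apply same_tree_unfold.
Qed.

Lemma same_tree_sym T U : same_tree T U -> same_tree U T.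
Proof.
  intros H. exists (fun X Y => same_tree Y X). split; [|exact H].
  clear T U H; intros T U H.
  destruct (same_tree_unfold H) as [T' U' HT HU | T' U' bs cs HT HU [H1 H2] | T' U' bs cs HT HU [H1 H2]].
  - apply tree_End; auto.
  - eapply tree_Bra; eauto; split; auto.
  - eapply tree_Sel; eauto; split; auto.
Qed.

Lemma same_summands_comp (R1 R2 : ty L -> ty L -> Prop) bs cs ds :
  same_summands R1 bs cs -> same_summands R2 cs ds ->
  same_summands (fun X Z => exists Y, R1 X Y /\ R2 Y Z) bs ds.
Proof.
  intros [H1 H2] [H3 H4]; split.
  - intros l S T Hin. destruct (H1 _ _ _ Hin) as (S' & T' & Hin' & ? & ?).
    destruct (H3 _ _ _ Hin') as (S'' & T'' & ? & ? & ?). eauto 10.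
  - intros l S T Hin. destruct (H4 _ _ _ Hin) as (S' & T' & Hin' & ? & ?).
    destruct (H2 _ _ _ Hin') as (S'' & T'' & ? & ? & ?). eauto 10.
Qed.

Lemma same_tree_trans T U V : same_tree T U -> same_tree U V -> same_tree T V.
Proof.
  intros H1 H2.
  exists (fun X Z => exists Y, same_tree X Y /\ same_tree Y Z). split; [|eauto].
  clear T U V H1 H2. intros T V (U & H1 & H2).
  apply same_tree_unfold in H1; apply same_tree_unfold in H2.
  destruct H1 as [T U H1 H1'|T U ? ? H1 H1' E1|T U ? ? H1 H1' E1];
  destruct H2 as [U V H2 H2'|U V ? ? H2 H2' E2|U V ? ? H2 H2' E2];
  pose proof (unfolds_det H1' H2) as E; try discriminate E.
  - apply tree_End; auto.
  - injection E as <-. eapply tree_Bra; eauto using same_summands_comp.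
  - injection E as <-. eapply tree_Sel; eauto using same_summands_comp.
Qed.

Lemma ty_eq_sym T U : ty_eq T U -> ty_eq U T.
Proof. intros (? & ? & ?); repeat split; auto using same_tree_sym. Qed.

Lemma ty_eq_trans T U V : ty_eq T U -> ty_eq U V -> ty_eq T V.
Proof.
  intros (? & ? & ?) (? & ? & ?); repeat split; eauto using same_tree_trans.
Qed.

(** On closed types [ty_eq] is reflexive, but it is enough here that it is a
    partial equivalence: no type occurs that is not related to some type. *)
Lemma ty_eq_refl_l T U : ty_eq T U -> ty_eq T T.
Proof. eauto using ty_eq_trans, ty_eq_sym. Qed.

Lemma closed_Bra_inv bs : closed_type (L := L) (Bra bs) ->
  NoDup (labels bs) /\
  forall l S T, In (l, S, T) bs -> closed_type S /\ closed_type T.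
Proof. intros H; inversion H; subst; split; unfold closed_type; eauto. Qed.

Lemma closed_Sel_inv bs : closed_type (L := L) (Sel bs) ->
  NoDup (labels bs) /\
  forall l S T, In (l, S, T) bs -> closed_type S /\ closed_type T.
Proof. intros H; inversion H; subst; split; unfold closed_type; eauto. Qed.

Lemma ty_eq_Bra_inv bs cs : ty_eq (L := L) (Bra bs) (Bra cs) ->
  forall l S T, In (l, S, T) bs ->
  exists S' T', In (l, S', T') cs /\ ty_eq S S' /\ ty_eq T T'.
Proof.
  intros (H1 & H2 & H) l S T Hin.
  apply same_tree_unfold in H.
  inversion H as [? ? A B|? ? ? ? A B C|? ? ? ? A B C]; subst;
    inversion A; inversion B; subst.
  destruct C as [C _]. destruct (C _ _ _ Hin) as (S' & T' & Hin' & ? & ?).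
  destruct (proj2 (closed_Bra_inv H1) _ _ _ Hin).
  destruct (proj2 (closed_Bra_inv H2) _ _ _ Hin').
  exists S', T'; repeat split; auto.
Qed.

Lemma ty_eq_Sel_inv bs cs : ty_eq (L := L) (Sel bs) (Sel cs) ->
  forall l S T, In (l, S, T) bs ->
  exists S' T', In (l, S', T') cs /\ ty_eq S S' /\ ty_eq T T'.
Proof.
  intros (H1 & H2 & H) l S T Hin.
  apply same_tree_unfold in H.
  inversion H as [? ? A B|? ? ? ? A B C|? ? ? ? A B C]; subst;
    inversion A; inversion B; subst.
  destruct C as [C _]. destruct (C _ _ _ Hin) as (S' & T' & Hin' & ? & ?).
  destruct (proj2 (closed_Sel_inv H1) _ _ _ Hin).
  destruct (proj2 (closed_Sel_inv H2) _ _ _ Hin').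
  exists S', T'; repeat split; auto.
Qed.

Lemma ty_eq_Bra bs cs :
  NoDup (labels bs) -> NoDup (labels cs) ->
  same_summands (@ty_eq L) bs cs -> ty_eq (Bra bs) (Bra cs).
Proof.
  intros Hb Hc H. repeat split.
  - apply wf_Bra; auto; intros l S T Hin;
    destruct (proj1 H _ _ _ Hin) as (? & ? & ? & E1 & E2);
    first [apply E1 | apply E2].
  - apply wf_Bra; auto; intros l S T Hin;
    destruct (proj2 H _ _ _ Hin) as (? & ? & ? & E1 & E2);
    first [apply E1 | apply E2].
  - apply same_tree_fold.
    eapply tree_Bra; [constructor|constructor|].
    revert H; apply same_summands_mono. intros ? ? H; apply H.
Qed.

Lemma not_ty_eq_Bra_Sel bs cs : ~ ty_eq (L := L) (Bra bs) (Sel cs).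
Proof.
  intros (_ & _ & H). apply same_tree_unfold in H.
  inversion H as [? ? A B|? ? ? ? A B C|? ? ? ? A B C]; inversion A; inversion B.
Qed.

Lemma not_ty_eq_Bra_End bs : ~ ty_eq (L := L) (Bra bs) End.
Proof.
  intros (_ & _ & H). apply same_tree_unfold in H.
  inversion H as [? ? A B|? ? ? ? A B C|? ? ? ? A B C]; inversion A; inversion B.
Qed.

Lemma not_ty_eq_Sel_End bs : ~ ty_eq (L := L) (Sel bs) End.
Proof.
  intros (_ & _ & H). apply same_tree_unfold in H.
  inversion H as [? ? A B|? ? ? ? A B C|? ? ? ? A B C]; inversion A; inversion B.
Qed.

(** * The condition that every path meets a branching, on types and on trees *)

(** Unlike [has_bra], [tree_bra] depends only on the tree of a type. *)
Inductive tree_bra : ty L -> Prop :=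
| tree_bra_Bra T bs : unfolds T (Bra bs) -> tree_bra T
| tree_bra_Sel T bs : unfolds T (Sel bs) ->
    (forall l S T', In (l, S, T') bs -> tree_bra T') -> tree_bra T.

Lemma tree_bra_Mu t T : tree_bra (subst t (Mu t T) T) -> tree_bra (Mu t T).
Proof.
  intros H; inversion H; subst.
  - eapply tree_bra_Bra; constructor; eauto.
  - eapply tree_bra_Sel; [constructor; eauto|auto].
Qed.

(** The head of the list is substituted first, so a pair appended at the end acts last. *)
Definition substs (s : list (nat * ty L)) T : ty L :=
  fold_left (fun T' '(t, U) => subst t U T') s T.

Lemma substs_Bra s bs : exists bs', substs s (Bra bs) = Bra bs'.
Proof.
  revert bs; induction s as [|[t U] s IH]; intros bs; simpl; [eauto|apply IH].
Qed.

Lemma substs_Sel s bs : exists bs', substs s (Sel bs) = Sel bs' /\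
  forall l S T, In (l, S, T) bs' -> exists T', In (l, S, T') bs /\ T = substs s T'.
Proof.
  revert bs; induction s as [|[t U] s IH]; intros bs; simpl; [eauto|].
  destruct (IH (map (fun '(l, S0, T') => (l, S0, subst t U T')) bs)) as (bs' & E & H).
  exists bs'; split; [exact E|]. intros l S T Hin.
  destruct (H _ _ _ Hin) as (T' & Hin' & ->).
  apply in_map_iff in Hin' as ([[l0 S0] T0] & E' & Hin').
  injection E' as <- <- <-. eauto.
Qed.

(** The binder shadows [t]: the list [s'] is [s] without its pairs for [t]. *)
Lemma substs_Mu s t T : exists s', substs s (Mu t T) = Mu t (substs s' T).
Proof.
  revert T; induction s as [|[u U] s IH]; intros T; simpl.
  - exists []; reflexivity.
  - destruct (Nat.eqb t u); [apply IH|].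
    destruct (IH (subst u U T)) as [s' E]. exists ((u, U) :: s'); exact E.
Qed.

(* Unfolding a recursion substitutes inside the derivation, so the induction has
   to be carried out for all substitution instances at once. *)
Lemma has_bra_substs T : has_bra T -> forall s, tree_bra (substs s T).
Proof.
  induction 1 as [bs|bs _ IH|t T _ IH]; intros s.
  - destruct (substs_Bra s bs) as [bs' ->]. eapply tree_bra_Bra; constructor.
  - destruct (substs_Sel s bs) as (bs' & -> & H).
    eapply tree_bra_Sel; [constructor|]. intros l S T Hin.
    destruct (H _ _ _ Hin) as (T' & Hin' & ->). eauto.
  - destruct (substs_Mu s t T) as [s' ->]. apply tree_bra_Mu.
    (* The appended pair acts last, so this instance is exactly the unfolding of
       [Mu t (substs s' T)]. *)
    specialize (IH (s' ++ [(t, Mu t (substs s' T))])).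
    unfold substs in *. rewrite fold_left_app in IH. exact IH.
Qed.

Lemma has_bra_tree_bra T : has_bra T -> tree_bra T.
Proof. intros H; exact (has_bra_substs H []). Qed.

(** A derivation for the instance either stays inside [T] or enters a copy of [U]. Deciding
    [has_bra U] beforehand treats all summands of a selection uniformly: if it fails, no copy of [U]
    can be entered. *)
Lemma has_bra_subst_inv t U T :
  has_bra (subst t U T) -> has_bra T \/ has_bra U.
Proof.
  destruct (classic (has_bra U)) as [HU|HU]; [auto|]. intros H; left.
  remember (subst t U T) as X eqn:E. revert T E.
  induction H as [bs|bs Hbs IH|u X HX IH]; intros T E.
  - destruct T as [ds|ds|v|v T|]; simpl in E; try discriminate; [constructor| |].
    + destruct (Nat.eqb v t); [subst; destruct HU; constructor|discriminate].
    + destruct (Nat.eqb v t); discriminate.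
  - destruct T as [ds|ds|v|v T|]; simpl in E; try discriminate.
    + injection E as ->. constructor. intros l S T Hin.
      eapply IH; [|reflexivity]. apply in_map_iff.
      exists (l, S, T); split; [reflexivity|exact Hin].
    + destruct (Nat.eqb v t); [subst; destruct HU; constructor; auto|discriminate].
    + destruct (Nat.eqb v t); discriminate.
  - destruct T as [ds|ds|v|v T|]; simpl in E; try discriminate.
    + destruct (Nat.eqb v t); [subst; destruct HU; constructor; auto|discriminate].
    + destruct (Nat.eqb v t); injection E as -> ->; constructor; auto.
Qed.

(** Undoing an unfolding leaves the predicate true of the body or of the recursion itself, and
    either suffices. *)
Lemma has_bra_unfolds T U : unfolds T U -> has_bra U -> has_bra T.
Proof.
  induction 1 as [| | |t T U _ IH]; intros H; auto.
  destruct (has_bra_subst_inv _ _ _ (IH H)); [constructor|]; auto.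
Qed.

Lemma tree_bra_has_bra T : tree_bra T -> has_bra T.
Proof.
  induction 1 as [T bs H|T bs H _ IH]; eapply has_bra_unfolds; eauto;
    constructor; auto.
Qed.

(** Each constructor inspects only the head reached by unfolding, which bisimilar types share up to
    bisimilar summands. *)
Lemma same_tree_tree_bra T U : tree_bra T -> same_tree T U -> tree_bra U.
Proof.
  intros H; revert U; induction H as [T bs H|T bs H _ IH]; intros U E;
  apply same_tree_unfold in E;
  destruct E as [T U A B|T U ? ? A B C|T U ? ? A B C];
  pose proof (unfolds_det H A) as E; try discriminate E; injection E as <-.
  - eapply tree_bra_Bra; eauto.
  - eapply tree_bra_Sel; [exact B|]. intros l S T' Hin.
    destruct (proj2 C _ _ _ Hin) as (? & ? & ? & ? & ?). eauto.
Qed.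

End Trees.

(** * Asynchronous subtyping as a greatest fixed point, up to tree equality *)

Section Subtyping.
Variable L : Type.
Implicit Types T U V S : ty L.

Lemma async_step_mono (R R' : ty L -> ty L -> Prop) T S :
  (forall T' S', R T' S' -> R' T' S') -> async_step R T S -> async_step R' T S.
Proof.
  intros HR H; destruct H as [T S HT HS|T S bs cs HT HS H|T S bs cs HT HS H
    |T S bs A cs HA HN HT HS H].
  - apply async_end; auto.
  - apply async_bra with bs cs; auto. intros l S' T' Hin.
    destruct (H _ _ _ Hin) as (S1 & T1 & ? & ? & ?); exists S1, T1; auto.
  - apply async_sel with bs cs; auto. intros l S' T' Hin.
    destruct (H _ _ _ Hin) as (S1 & T1 & ? & ? & ?); exists S1, T1; auto.
  - apply async_selA with bs A cs; auto. intros l S' T' Hin.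
    destruct (H _ _ _ Hin) as (Sn & Tn & Hn & ? & ?).
    exists Sn, Tn; repeat split; auto; intros; apply Hn || apply HR, Hn; auto.
Qed.

Lemma async_sub_unfold T S : async_sub T S -> async_step (@async_sub L) T S.
Proof.
  intros (R & HR & H). apply async_step_mono with (R := R); [|auto].
  intros T' U' H'; exists R; auto.
Qed.

Lemma async_sub_fold T S : async_step (@async_sub L) T S -> async_sub T S.
Proof.
  intros H. exists (async_step (@async_sub L)). split; [|exact H].
  intros T' S' H'. apply async_step_mono with (R := @async_sub L); [|exact H'].
  apply async_sub_unfold.
Qed.

(** Every rule mentions its two types only through [ty_eq], so a single unfolding suffices. *)
Lemma async_sub_ty_eq_l T T' S : ty_eq T T' -> async_sub T S -> async_sub T' S.
Proof.
  intros E H; apply async_sub_fold; apply async_sub_unfold in H.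
  apply ty_eq_sym in E.
  destruct H.
  - apply async_end; eauto using ty_eq_trans.
  - eapply async_bra; eauto using ty_eq_trans.
  - eapply async_sel; eauto using ty_eq_trans.
  - eapply async_selA; eauto using ty_eq_trans.
Qed.

Lemma async_sub_ty_eq_r T S S' : ty_eq S S' -> async_sub T S -> async_sub T S'.
Proof.
  intros E H; apply async_sub_fold; apply async_sub_unfold in H.
  apply ty_eq_sym in E.
  destruct H.
  - apply async_end; eauto using ty_eq_trans.
  - eapply async_bra; eauto using ty_eq_trans.
  - eapply async_sel; eauto using ty_eq_trans.
  - eapply async_selA; eauto using ty_eq_trans.
Qed.

(** * Branchings on all paths are inherited by subtypes *)

(** Induction on the predicate for [V0]; the type [V] varies up to tree equality because the rules
    expose its summands only up to [ty_eq]. *)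
Lemma async_sub_tree_bra V0 :
  tree_bra V0 -> forall T V, same_tree V0 V -> async_sub T V -> tree_bra T.
Proof.
  assert (Hb : forall T bs, ty_eq T (Bra bs) -> tree_bra T).
  { intros T bs (_ & _ & E). apply same_tree_sym in E.
    eapply same_tree_tree_bra; [|exact E]. eapply tree_bra_Bra; constructor. }
  assert (Hs : forall T bs, ty_eq T (Sel bs) ->
    (forall l S T', In (l, S, T') bs -> tree_bra T') -> tree_bra T).
  { intros T bs (_ & _ & E) H. apply same_tree_sym in E.
    eapply same_tree_tree_bra; [|exact E]. eapply tree_bra_Sel; [constructor|auto]. }
  assert (He : forall V, tree_bra V -> ~ ty_eq V End).
  { intros V H (_ & _ & E). pose proof (same_tree_tree_bra H E) as H'.
    inversion H' as [? ? A|? ? A]; inversion A. }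
  induction 1 as [V0 bs0 H0|V0 bs0 H0 Hbs0 IH]; intros T V E H;
  apply async_sub_unfold in H;
  destruct H as [T V HT HV|T V bs cs HT HV H|T V bs cs HT HV H
    |T V bs A cs HA HN HT HV H].
  (* In the two cases where [V] equals [End], the predicate transported from [V0] is
     contradictory. *)
  1,5: destruct (He V); [|exact HV]; eapply same_tree_tree_bra; [|exact E].
  1: eapply tree_bra_Bra; eauto.
  1: eapply tree_bra_Sel; eauto.
  1,4: eauto.
  (* Anticipation carries [has_bra] of each continuation of [T] as a side condition. *)
  2,4: apply Hs with bs; [exact HT|]; intros l S T' Hin;
    destruct (H _ _ _ Hin) as (? & ? & ? & ? & ?); auto using has_bra_tree_bra.
  (* What remains is the plain selection rule. There [V] is a selection, so a branching [V0] is
     impossible; for a selection [V0] the induction hypothesis applies to each continuation. *)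
  all: pose proof (same_tree_trans E (proj2 (proj2 HV))) as E';
    apply same_tree_unfold in E';
    inversion E' as [? ? A B|? ? ? ? A B C|? ? ? ? A B C]; subst;
    inversion B; subst;
    pose proof (unfolds_det H0 A) as E''; try discriminate E''; injection E'' as <-.
  apply Hs with bs; [exact HT|]; intros l S T' Hin.
  destruct (H _ _ _ Hin) as (S1 & T1 & Hin1 & _ & Hsub).
  destruct (proj2 C _ _ _ Hin1) as (S2 & T2 & Hin2 & _ & Ht). eauto.
Qed.

Lemma async_sub_has_bra T V :
  ty_eq V V -> async_sub T V -> has_bra V -> has_bra T.
Proof.
  intros (_ & _ & E) H HV. apply tree_bra_has_bra.
  eapply async_sub_tree_bra; eauto using has_bra_tree_bra.
Qed.

(** * Filling and renaming asynchronous contexts *)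

Lemma actx_list_ind (P : actx L -> Prop) :
  (forall n, P (Hole n)) ->
  (forall bs, (forall l S A, In (l, S, A) bs -> P A) -> P (CBra bs)) ->
  forall A, P A.
Proof.
  intros H1 H2. fix IH 1. intros [n|bs]; [apply H1|]. apply H2.
  induction bs as [|[[l S] A] bs IHbs]; intros l' S' A'; simpl; [tauto|].
  intros [E|Hin]; [|exact (IHbs _ _ _ Hin)]. injection E as <- <- <-. apply IH.
Qed.

Lemma in_fill_branches (bs : list (L * ty L * actx L)) F l S T :
  In (l, S, T) (map (fun '(l, S0, A') => (l, S0, fill A' F)) bs) <->
  exists A, In (l, S, A) bs /\ T = fill A F.
Proof.
  rewrite in_map_iff. split.
  - intros ([[l0 S0] A] & E & Hin). injection E as <- <- <-; eauto.
  - intros (A & Hin & ->). exists (l, S, A); auto.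
Qed.

Lemma labels_fill_branches (bs : list (L * ty L * actx L)) F :
  labels (map (fun '(l, S0, A') => (l, S0, fill A' F)) bs) = labels bs.
Proof.
  unfold labels. rewrite map_map. apply map_ext. intros [[? ?] ?]; reflexivity.
Qed.

Lemma in_holes_CBra (bs : list (L * ty L * actx L)) l S A n :
  In (l, S, A) bs -> In n (holes A) -> In n (holes (CBra bs)).
Proof. simpl; intros H1 H2. apply in_flat_map. exists (l, S, A); auto. Qed.

Lemma fill_ext (A : actx L) F G :
  (forall n, In n (holes A) -> F n = G n) -> fill A F = fill A G.
Proof.
  induction A as [n|bs IH] using actx_list_ind; intros H; simpl; [apply H; simpl; auto|].
  f_equal. apply map_ext_in. intros [[l S] A] Hin. f_equal.
  eapply IH; [exact Hin|]. eauto using in_holes_CBra.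
Qed.

(** Self-equality serves as well-formedness. Filling changes neither the labels nor the exchanged
    types of [A], so only the contents of the holes need checking again. *)
Lemma ty_eq_fill (A : actx L) F G :
  ty_eq (fill A F) (fill A F) ->
  (forall n, In n (holes A) -> ty_eq (F n) (F n) -> ty_eq (G n) (G n)) ->
  ty_eq (fill A G) (fill A G).
Proof.
  induction A as [n|bs IH] using actx_list_ind; simpl; intros E H; [auto|].
  pose proof (proj1 (closed_Bra_inv (proj1 E))) as Hnd.
  rewrite labels_fill_branches in Hnd.
  assert (Hx : forall l S T,
    In (l, S, T) (map (fun '(l, S0, A') => (l, S0, fill A' G)) bs) ->
    ty_eq S S /\ ty_eq T T).
  { intros l S T Hin. apply in_fill_branches in Hin as (A & Hin & ->).
    destruct (ty_eq_Bra_inv E) with l S (fill A F) as (S' & T' & _ & ES & ET).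
    { apply in_fill_branches; eauto. }
    split; [eauto using ty_eq_refl_l|].
    eapply IH; eauto using ty_eq_refl_l, in_holes_CBra. }
  apply ty_eq_Bra; rewrite ?labels_fill_branches; auto.
  split; intros l S T Hin; destruct (Hx _ _ _ Hin); eauto.
Qed.

Fixpoint rename (f : nat -> nat) (A : actx L) : actx L :=
  match A with
  | Hole n => Hole (f n)
  | CBra bs => CBra (map (fun '(l, S0, A') => (l, S0, rename f A')) bs)
  end.

Lemma fill_rename f A F : fill (rename f A) F = fill A (fun n => F (f n)).
Proof.
  induction A as [n|bs IH] using actx_list_ind; simpl; [reflexivity|].
  f_equal. rewrite map_map. apply map_ext_in. intros [[l S] A] Hin.
  f_equal. eauto.
Qed.

Lemma flat_map_holes_rename f (bs : list (L * ty L * actx L)) :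
  (forall l S A, In (l, S, A) bs -> holes (rename f A) = map f (holes A)) ->
  flat_map (fun '(_, _, A') => holes A')
    (map (fun '(l, S0, A') => (l, S0, rename f A')) bs) =
  map f (flat_map (fun '(_, _, A') => holes A') bs).
Proof.
  induction bs as [|[[l S] A] bs IH]; simpl; intros H; [reflexivity|].
  rewrite map_app, IH; [|eauto]. f_equal. eauto.
Qed.

Lemma holes_rename f A : holes (rename f A) = map f (holes A).
Proof.
  induction A as [n|bs IH] using actx_list_ind; simpl; [reflexivity|].
  apply flat_map_holes_rename; auto.
Qed.

(** Keeps the hole indices of two contexts apart by their parity. *)
Definition interleave (X : Type) (F G : nat -> X) (n : nat) : X :=
  if Nat.even n then F (Nat.div2 n) else G (Nat.div2 n).

Lemma interleave_even (X : Type) (F G : nat -> X) n :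
  interleave F G (2 * n) = F n.
Proof. unfold interleave. rewrite Nat.even_even, Nat.div2_double; reflexivity. Qed.

Lemma interleave_odd (X : Type) (F G : nat -> X) n :
  interleave F G (S (2 * n)) = G n.
Proof.
  unfold interleave. rewrite Nat.div2_succ_double.
  rewrite Nat.even_succ, Nat.odd_even; reflexivity.
Qed.

(** * Anticipating outputs past a context *)

(** The contexts and selections are fixed before the label [l], since [async_selA] needs one
    decomposition for all outputs. Holes of [A'] need not correspond to holes of [A], so [Sm m] is
    compared with some [Sn n]; this is enough when all [Sn n] lie below one common type. *)
Definition anticipates (A : actx L) (cs : nat -> list (L * ty L * ty L))
    (A' : actx L) (ds : nat -> list (L * ty L * ty L)) : Prop :=
  forall l Sn Tn, (forall n, In n (holes A) -> In (l, Sn n, Tn n) (cs n)) ->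
  exists Sm Tm,
    (forall m, In m (holes A') -> In (l, Sm m, Tm m) (ds m) /\
       exists n, In n (holes A) /\ async_sub (Sm m) (Sn n)) /\
    async_sub (fill A Tn) (fill A' Tm).

(** Contexts found separately for the branches in [es] may share hole indices. Going through [es],
    the new branch is moved to even indices and those already merged to odd ones. The list [bs]
    stays fixed, because a supertype may have fewer branches. Subtyping is stated branch by branch,
    which keeps the induction free of well-formedness conditions on [es]. *)
Lemma merge_branches (bs : list (L * ty L * actx L)) cs
    (es : list (L * ty L * ty L)) :
  (forall l S' T', In (l, S', T') es -> exists S0 A A' ds,
     In (l, S0, A) bs /\ async_sub S0 S' /\ NoDup (holes A') /\
     ty_eq T' (fill A' (fun m => Sel (ds m))) /\ anticipates A cs A' ds) ->
  exists bs' ds,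
    labels bs' = labels es /\ NoDup (holes (CBra bs')) /\
    (forall l S' T', In (l, S', T') es -> exists A',
       In (l, S', A') bs' /\ ty_eq T' (fill A' (fun m => Sel (ds m)))) /\
    (forall l S' A', In (l, S', A') bs' -> exists T',
       In (l, S', T') es /\ ty_eq T' (fill A' (fun m => Sel (ds m)))) /\
    forall l Sn Tn,
      (forall n, In n (holes (CBra bs)) -> In (l, Sn n, Tn n) (cs n)) ->
      exists Sm Tm,
        (forall m, In m (holes (CBra bs')) -> In (l, Sm m, Tm m) (ds m) /\
           exists n, In n (holes (CBra bs)) /\ async_sub (Sm m) (Sn n)) /\
        (forall l' S' A', In (l', S', A') bs' -> exists S0 A,
           In (l', S0, A) bs /\ async_sub S0 S' /\
           async_sub (fill A Tn) (fill A' Tm)).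
Proof.
  induction es as [|[[l1 S1] T1] es IH]; intros H.
  (* Without branches there are no holes, so the selections and families are arbitrary. *)
  { exists [], (fun _ => []). repeat split; try (simpl; tauto || constructor).
    intros l Sn Tn _. exists Sn, Tn; split; simpl; tauto. }
  destruct IH as (bs2 & ds2 & Hlab & Hnd & He1 & He2 & Hant).
  { intros l S' T' Hin; apply H; right; exact Hin. }
  destruct (H l1 S1 T1 (or_introl eq_refl))
    as (S0 & A & A1 & ds1 & HA & HS0 & Hnd1 & HT1 & Hant1).
  clear H.
  (* After renaming, each part of the merged context reads only its own half of an interleaved
     family. *)
  assert (Fev : forall F G (B : actx L),
    fill (rename (fun n => 2 * n) B) (interleave F G) = fill B F).
  { intros F G B. rewrite fill_rename. apply fill_ext. intros n _.
    apply interleave_even. }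
  assert (Fod : forall F G (B : actx L),
    fill (rename (fun n => S (2 * n)) B) (interleave F G) = fill B G).
  { intros F G B. rewrite fill_rename. apply fill_ext. intros n _.
    apply interleave_odd. }
  assert (Gev : forall (B : actx L),
    fill (rename (fun n => 2 * n) B) (fun m => Sel (interleave ds1 ds2 m)) =
    fill B (fun m => Sel (ds1 m))).
  { intros B. rewrite fill_rename. apply fill_ext. intros n _.
    rewrite interleave_even; reflexivity. }
  assert (God : forall (B : actx L),
    fill (rename (fun n => S (2 * n)) B) (fun m => Sel (interleave ds1 ds2 m)) =
    fill B (fun m => Sel (ds2 m))).
  { intros B. rewrite fill_rename. apply fill_ext. intros n _.
    rewrite interleave_odd; reflexivity. }
  set (bs' := (l1, S1, rename (fun n => 2 * n) A1) ::
     map (fun '(l, S0, A') => (l, S0, rename (fun n => S (2 * n)) A')) bs2).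
  assert (Hin' : forall l S' A', In (l, S', A') bs' ->
    (l = l1 /\ S' = S1 /\ A' = rename (fun n => 2 * n) A1) \/
    exists A'', In (l, S', A'') bs2 /\ A' = rename (fun n => S (2 * n)) A'').
  { intros l S' A' [E|Hin]; [injection E as <- <- <-; auto|right].
    apply in_map_iff in Hin as ([[? ?] A''] & E & Hin).
    injection E as <- <- <-. eauto. }
  assert (Hholes : holes (CBra bs') =
    map (fun n => 2 * n) (holes A1) ++
    map (fun n => S (2 * n)) (holes (CBra bs2))).
  { rewrite <- !holes_rename. reflexivity. }
  exists bs', (interleave ds1 ds2).
  split; [|split; [|split; [|split]]].
  - unfold bs', labels in *; simpl. f_equal. rewrite <- Hlab, map_map.
    apply map_ext. intros [[? ?] ?]; reflexivity.
  - rewrite Hholes. apply NoDup_app.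
    + apply NoDup_map_NoDup_ForallPairs; [intros ? ? _ _; lia|exact Hnd1].
    + apply NoDup_map_NoDup_ForallPairs; [intros ? ? _ _; lia|exact Hnd].
    + intros n Hn1 Hn2. apply in_map_iff in Hn1 as (? & ? & _).
      apply in_map_iff in Hn2 as (? & ? & _). lia.
  - intros l S' T' [E|Hin].
    + injection E as <- <- <-. eexists; split; [left; reflexivity|].
      rewrite Gev; exact HT1.
    + destruct (He1 _ _ _ Hin) as (A' & HA' & E).
      exists (rename (fun n => S (2 * n)) A'); split; [right|rewrite God; exact E].
      apply in_map_iff. exists (l, S', A'); auto.
  - intros l S' A' Hin.
    destruct (Hin' _ _ _ Hin) as [(-> & -> & ->)|(A'' & Hin2 & ->)].
    + exists T1; rewrite Gev; simpl; auto.
    + destruct (He2 _ _ _ Hin2) as (T' & ? & ?).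
      exists T'; rewrite God; simpl; auto.
  - intros l Sn Tn Hn.
    (* An output offered in all holes of [CBra bs] is offered in particular in those of its branch
       [A]. *)
    destruct (Hant1 l Sn Tn) as (Sm1 & Tm1 & Hm1 & Hsub1).
    { intros n Hin. apply Hn. exact (in_holes_CBra _ _ _ _ _ HA Hin). }
    destruct (Hant l Sn Tn Hn) as (Sm2 & Tm2 & Hm2 & Hsub2).
    exists (interleave Sm1 Sm2), (interleave Tm1 Tm2). split.
    + intros m Hm. rewrite Hholes in Hm.
      apply in_app_or in Hm as [Hm|Hm]; apply in_map_iff in Hm as (k & <- & Hk).
      * rewrite !interleave_even. destruct (Hm1 _ Hk) as (? & n & ? & ?).
        split; [assumption|]. exists n; split; [|assumption].
        eapply in_holes_CBra; eauto.
      * rewrite !interleave_odd. auto.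
    + intros l' S' A' Hin.
      destruct (Hin' _ _ _ Hin) as [(-> & -> & ->)|(A'' & Hin2 & ->)].
      * exists S0, A; rewrite Fev; auto.
      * rewrite Fod; auto.
Qed.

(** Continuations of a well-formed selection are well-formed. This supplies the self-equalities
    demanded by [async_bra] for a context filled with continuations. *)
Lemma ty_eq_fill_continuations (A : actx L) cs l Sn Tn :
  ty_eq (fill A (fun n => Sel (cs n))) (fill A (fun n => Sel (cs n))) ->
  (forall n, In n (holes A) -> In (l, Sn n, Tn n) (cs n)) ->
  ty_eq (fill A Tn) (fill A Tn).
Proof.
  intros E H. eapply ty_eq_fill; [exact E|]. intros n Hn En.
  destruct (ty_eq_Sel_inv En _ _ _ (H n Hn)) as (? & ? & _ & _ & ET).
  exact (ty_eq_refl_l ET).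
Qed.

(** Here [V] is a filled context only up to [ty_eq], as the summands met in the induction are. The
    clause on [ctx_has_bra] later provides the side condition of [async_selA]. *)
Lemma async_sub_fill_inv (A : actx L) cs V S :
  ty_eq V (fill A (fun n => Sel (cs n))) -> async_sub V S ->
  exists A' ds,
    NoDup (holes A') /\ ty_eq S (fill A' (fun m => Sel (ds m))) /\
    (ctx_has_bra A -> ctx_has_bra A') /\ anticipates A cs A' ds.
Proof.
  revert V S; induction A as [k|bs IH] using actx_list_ind; intros V S E H;
    apply async_sub_unfold in H; simpl in E.
  - destruct H as [V S HT HS|V S bs es HT HS H|V S bs es HT HS H
      |V S bs A es HA HN HT HS H];
    apply ty_eq_sym in HT; pose proof (ty_eq_trans HT E) as E'.
    + destruct (not_ty_eq_Sel_End (ty_eq_sym E')).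
    + destruct (not_ty_eq_Bra_Sel E').
    (* By the plain selection rule [S] is a selection, so a single hole suffices; its index is
       arbitrary and the families are constant. *)
    + exists (Hole 0), (fun _ => es). split; [|split; [|split]].
      * repeat constructor; simpl; tauto.
      * exact HS.
      * intros Hk; destruct (Hk k); reflexivity.
      * intros l Sn Tn Hn. simpl in *.
        destruct (ty_eq_Sel_inv (ty_eq_sym E') _ _ _ (Hn k (or_introl eq_refl)))
          as (S1 & T1 & Hin & ES & ET).
        destruct (H _ _ _ Hin) as (S2 & T2 & Hin2 & HS2 & HT2).
        exists (fun _ => S2), (fun _ => T2). split.
        -- intros m _; split; [exact Hin2|]. exists k; split; [auto|].
           eauto using async_sub_ty_eq_r, ty_eq_sym.
        -- eauto using async_sub_ty_eq_l, ty_eq_sym.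
    (* By the anticipation rule [S] already has the required form, with the context of that rule. *)
    + exists A, es. split; [|split; [|split]]; auto.
      intros l Sn Tn Hn. simpl in *.
      destruct (ty_eq_Sel_inv (ty_eq_sym E') _ _ _ (Hn k (or_introl eq_refl)))
        as (S1 & T1 & Hin & ES & ET).
      destruct (H _ _ _ Hin) as (Sm & Tm & Hm & Hsub & _).
      exists Sm, Tm; split.
      * intros m Hin'; destruct (Hm _ Hin'); split; [assumption|].
        exists k; split; [auto|]. eauto using async_sub_ty_eq_r, ty_eq_sym.
      * eauto using async_sub_ty_eq_l, ty_eq_sym.
  - destruct H as [V S HT HS|V S bs0 es HT HS H|V S bs0 es HT HS H
      |V S bs0 A es HA HN HT HS H];
    apply ty_eq_sym in HT; pose proof (ty_eq_trans HT E) as E'.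
    (* As [V] is a branching, only [async_bra] survives. *)
    1: destruct (not_ty_eq_Bra_End (ty_eq_sym E')).
    2,3: destruct (not_ty_eq_Bra_Sel (ty_eq_sym E')).
    destruct (@merge_branches bs cs es) as (bs' & ds & Hlab & Hnd & He1 & He2 & Hant).
    { intros l S' T' Hin. destruct (H _ _ _ Hin) as (S1 & T1 & Hin1 & HS1 & HT1).
      destruct (ty_eq_Bra_inv E' _ _ _ Hin1) as (S2 & T2 & Hin2 & ES & ET).
      apply in_fill_branches in Hin2 as (A & HA & ->).
      destruct (IH _ _ _ HA _ _ ET HT1) as (A' & ds & ? & ? & _ & ?).
      exists S2, A, A', ds. eauto 10 using async_sub_ty_eq_l. }
    assert (ES : ty_eq S (fill (CBra bs') (fun m => Sel (ds m)))).
    { apply (ty_eq_trans HS). simpl.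
      pose proof (ty_eq_Bra_inv (ty_eq_refl_l (ty_eq_sym HS))) as Hinv.
      pose proof (proj1 (closed_Bra_inv (proj1 (proj2 HS)))) as Hnd'.
      apply ty_eq_Bra; rewrite ?labels_fill_branches, ?Hlab; auto.
      split.
      - intros l S1 T1 Hin. destruct (Hinv _ _ _ Hin) as (? & ? & _ & ? & _).
        destruct (He1 _ _ _ Hin) as (A' & HA' & ?).
        exists S1, (fill A' (fun m => Sel (ds m))).
        rewrite in_fill_branches. eauto 6 using ty_eq_refl_l.
      - intros l S1 T1 Hin. apply in_fill_branches in Hin as (A' & HA' & ->).
        destruct (He2 _ _ _ HA') as (T' & Hin & ?).
        destruct (Hinv _ _ _ Hin) as (? & ? & _ & ? & _).
        exists S1, T'. eauto using ty_eq_refl_l. }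
    exists (CBra bs'), ds. split; [|split; [|split]]; auto.
    { intros _ n; discriminate. }
    intros l Sn Tn Hn. destruct (Hant l Sn Tn Hn) as (Sm & Tm & Hm & Hsub).
    exists Sm, Tm; split; [exact Hm|].
    (* Both filled contexts are branchings, and [Hsub] relates their branches as [async_bra]
       requires. *)
    apply async_sub_fold. simpl. eapply async_bra.
    + apply (@ty_eq_fill_continuations (CBra bs) cs l Sn Tn);
        eauto using ty_eq_refl_l, ty_eq_sym.
    + apply (@ty_eq_fill_continuations (CBra bs') ds l Sm Tm);
        [eauto using ty_eq_refl_l, ty_eq_sym|apply Hm].
    + intros l' S' T' Hin. apply in_fill_branches in Hin as (A' & HA' & ->).
      destruct (Hsub _ _ _ HA') as (S0 & A & HA & ? & ?).
      exists S0, (fill A Tn). rewrite in_fill_branches. eauto 6.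
Qed.

(** * Closure of the relational square under the subtyping rules *)

Definition async_sub_comp T S : Prop :=
  exists V, async_sub T V /\ async_sub V S.

Lemma async_sub_comp_step T S :
  async_sub_comp T S -> async_step async_sub_comp T S.
Proof.
  intros (V & HTV & HVS). apply async_sub_unfold in HTV.
  destruct HTV as [T V HT HV|T V bs cs HT HV H|T V bs cs HT HV H
    |T V bs A cs HA HN HT HV H].
  - apply async_sub_unfold in HVS.
    destruct HVS as [V S HV' HS|V S bs' ds HV' HS H'|V S bs' ds HV' HS H'
      |V S bs' A ds HA HN HV' HS H'];
    pose proof (ty_eq_trans (ty_eq_sym HV') HV) as E.
    + apply async_end; auto.
    + destruct (not_ty_eq_Bra_End E).
    + destruct (not_ty_eq_Sel_End E).
    + destruct (not_ty_eq_Sel_End E).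
  - apply async_sub_unfold in HVS.
    destruct HVS as [V S HV' HS|V S bs' ds HV' HS H'|V S bs' ds HV' HS H'
      |V S bs' A ds HA HN HV' HS H'];
    pose proof (ty_eq_trans (ty_eq_sym HV) HV') as E.
    + destruct (not_ty_eq_Bra_End E).
    + apply async_bra with bs ds; auto. intros l S3 T3 Hin3.
      destruct (H' _ _ _ Hin3) as (S2 & T2 & Hin2 & ? & ?).
      destruct (ty_eq_Bra_inv (ty_eq_sym E) _ _ _ Hin2) as (S1 & T1 & Hin1 & ? & ?).
      destruct (H _ _ _ Hin1) as (S0 & T0 & Hin0 & ? & ?).
      exists S0, T0; repeat split; auto; unfold async_sub_comp;
        eauto using async_sub_ty_eq_r, ty_eq_sym.
    + destruct (not_ty_eq_Bra_Sel E).
    + destruct (not_ty_eq_Bra_Sel E).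
  - apply async_sub_unfold in HVS.
    destruct HVS as [V S HV' HS|V S bs' ds HV' HS H'|V S bs' ds HV' HS H'
      |V S bs' A ds HA HN HV' HS H'];
    pose proof (ty_eq_trans (ty_eq_sym HV) HV') as E.
    + destruct (not_ty_eq_Sel_End E).
    + destruct (not_ty_eq_Bra_Sel (ty_eq_sym E)).
    + apply async_sel with bs ds; auto. intros l S0 T0 Hin0.
      destruct (H _ _ _ Hin0) as (S1 & T1 & Hin1 & ? & ?).
      destruct (ty_eq_Sel_inv E _ _ _ Hin1) as (S2 & T2 & Hin2 & ? & ?).
      destruct (H' _ _ _ Hin2) as (S3 & T3 & Hin3 & ? & ?).
      exists S3, T3; repeat split; auto; unfold async_sub_comp;
        eauto using async_sub_ty_eq_l, async_sub_ty_eq_r, ty_eq_sym.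
    (* A plain selection step followed by an anticipation is an anticipation past the same
       context. *)
    + apply async_selA with bs A ds; auto. intros l S0 T0 Hin0.
      destruct (H _ _ _ Hin0) as (S1 & T1 & Hin1 & ? & ?).
      destruct (ty_eq_Sel_inv E _ _ _ Hin1) as (S2 & T2 & Hin2 & ? & ?).
      destruct (H' _ _ _ Hin2) as (Sn & Tn & Hn & ? & ?).
      exists Sn, Tn; repeat split.
      * apply Hn; assumption.
      * exists S1; split; [|assumption].
        eapply async_sub_ty_eq_r; [apply ty_eq_sym; eassumption|apply Hn; auto].
      * exists T2; split; [|assumption]. eauto using async_sub_ty_eq_r.
      (* The second derivation gives the condition for [T2]; it passes down to its subtype [T0]. *)
      * apply async_sub_has_bra with T2; auto;
          eauto using async_sub_ty_eq_r, ty_eq_refl_l, ty_eq_sym.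
  - destruct (async_sub_fill_inv _ _ HV HVS) as (A' & ds & Hnd & HS & HA' & Hant).
    apply async_selA with bs A' ds; auto. intros l Si Ti Hin.
    destruct (H _ _ _ Hin) as (Sn & Tn & Hn & Hsub & Hbra).
    destruct (Hant l Sn Tn) as (Sm & Tm & Hm & Hsub').
    { intros n Hin'; apply Hn, Hin'. }
    (* The summands of [T] are those of the first derivation, so its side condition [Hbra] is
       reused. The intermediate types are [Sn n] for the exchanged types and [fill A Tn] for the
       continuations. *)
    exists Sm, Tm; split; [|split; [|exact Hbra]].
    + intros m Hin'. destruct (Hm _ Hin') as (? & n & Hn' & ?).
      split; [assumption|]. exists (Sn n); split; [assumption|]. apply Hn, Hn'.
    + exists (fill A Tn); auto.
Qed.

End Subtyping.

Theorem theorem4p8 (L : Type) (T V S : ty L)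
  (hT : closed_type T) (hV : closed_type V) (hS : closed_type S)
  (hTV : async_sub T V) (hVS : async_sub V S) :
  async_sub T S.
Proof.
  exists (@async_sub_comp L). split; [apply async_sub_comp_step|].
  exists V; auto.
Qed.
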